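(* Consider the min-max-energy platooning problem with arbitrary $n$ and $m$, in which $\delta_j=\delta$ for all $j$ and $S_{j1}C_j\ge\bar L$ for all $j$, where $\bar L$ is sufficiently large that every solution is feasible. The worst-case performance ratio of Algorithm HEU1 for this problem is bounded by $1+\frac{\eta_n-\eta_1}{1-\eta_1}$; that is, for every instance, if $Z^H$ is the objective value of the solution generated by HEU1 and $Z^*$ is the optimal objective value, then $$\frac{Z^H}{Z^*}\le1+\frac{\eta_n-\eta_1}{1-\eta_1}.$$
   Context: Setting. There are $n$ vehicles and $m$ road segments with lengths $D_1,\ldots,D_m>0$. Vehicle $j$ has battery capacity $C_j>0$, usage rate $\delta_j>0$, initial state of charge $S_{j1}\in[0,1]$, and minimum allowable state of charge $\beta_j$ with $0\le\beta_j<S_{j1}$. Platoon positions have usage-rate reductions $0\le\eta_1\le\cdots\le\eta_n<1$. A solution specifies for each segment $i$ a permutation of the positions; $j_i$ is the position of vehicle $j$ in segment $i$. The total energy usage of vehicle $j$ is $U_j=\delta_j\sum_{i=1}^mD_i(1-\eta_{j_i})$, and a solution is feasible if $S_{j1}-U_j/C_j\ge\beta_j$ for all $j$. The min-max-energy problem is to minimize $\max_jU_j$ over feasible solutions. The condition $S_{j1}C_j\ge\bar L$ means that initial energy levels are large enough that any solution is feasible, e.g. $\bar L\ge\beta_jC_j+\sum_{i=1}^mD_i(1-\eta_1)\delta_j$ for each $j$. Algorithm HEU1. Step 0: Reindex the segments so that $D_1\ge D_2\ge\cdots\ge D_m$. Let $E_{jh}$ denote the total energy used by vehicle $j$ after the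 first $h$ segments, with $E_{j0}=0$. Set $k=1$. Step 1: Sort the vehicles in non-decreasing order of $E_{j,k-1}$, breaking ties by increasing vehicle index, and assign the $h$th vehicle in this order to the $h$th position of segment $k$, for $h=1,\ldots,n$. Let $E_{jk}=E_{j,k-1}+D_k\delta_j(1-\eta_{[j]})$, where $[j]$ is the position assigned to vehicle $j$. Step 2: If $k=m$, stop and restore the original order of the segments; otherwise set $k=k+1$ and go to Step 1. *)

(* Defs.v *)
From HB Require Import structures.
From mathcomp Require Import all_boot all_order all_algebra all_fingroup.

Set Implicit Arguments.
Unset Strict Implicit.
Unset Printing Implicit Defensive.

Import Order.TTheory GRing.Theory Num.Theory.
Local Open Scope ring_scope.

(* There are n.+1 vehicles (and platoon positions) and m.+1 road segments, all
   indexed from 0: the reductions eta_1 and eta_n are [reduction I ord0] and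
   [reduction I ord_max]. *)
Record instance (R : realFieldType) (n m : nat) := Instance {
  seg_len : 'I_m.+1 -> R;
  capacity : 'I_n.+1 -> R;
  rate : 'I_n.+1 -> R;
  init_soc : 'I_n.+1 -> R;
  min_soc : 'I_n.+1 -> R;
  reduction : 'I_n.+1 -> R;
  seg_len_gt0 : forall i, 0 < seg_len i;
  capacity_gt0 : forall j, 0 < capacity j;
  rate_gt0 : forall j, 0 < rate j;
  init_soc_ge0 : forall j, 0 <= init_soc j;
  init_soc_le1 : forall j, init_soc j <= 1;
  min_soc_ge0 : forall j, 0 <= min_soc j;
  min_soc_lt : forall j, min_soc j < init_soc j;
  reduction_ge0 : forall p, 0 <= reduction p;
  reduction_mono : forall p q : 'I_n.+1, (p <= q)%N -> reduction p <= reduction q;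
  reduction_lt1 : forall p, reduction p < 1
}.

(* [x i j] is the position of vehicle j in segment i. *)
Definition solution (n m : nat) := {ffun 'I_m.+1 -> 'S_n.+1}.

Section Platooning.
Variables (R : realFieldType) (n m : nat) (I : instance R n m).

Definition energy (x : solution n m) (j : 'I_n.+1) : R :=
  rate I j * \sum_(i < m.+1) seg_len I i * (1 - reduction I (x i j)).

Definition feasible (x : solution n m) : Prop :=
  forall j, min_soc I j <= init_soc I j - energy x j / capacity I j.

Definition max_energy (x : solution n m) : R :=
  \big[Num.max/energy x ord0]_(j < n.+1) energy x j.

Definition optimal (x : solution n m) : Prop :=
  feasible x /\ forall y, feasible y -> max_energy x <= max_energy y.

Definition energy_level_at_least (L : R) : Prop :=
  forall j, L <= init_soc I j * capacity I j.

Definition sufficiently_large (L : R) : Prop :=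
  energy_level_at_least L -> forall x, feasible x.

(* [s k] is the original index of the segment that is renumbered k.  Segments
   of equal length may be renumbered in any relative order. *)
Definition nonincreasing_reindexing (s : 'S_m.+1) : Prop :=
  forall i k : 'I_m.+1, (i <= k)%N -> seg_len I (s k) <= seg_len I (s i).

Definition vehicle_le (E : 'I_n.+1 -> R) : rel 'I_n.+1 :=
  fun a b => (E a < E b) || (E a == E b) && (a <= b)%N.

Definition vehicle_order (E : 'I_n.+1 -> R) : n.+1.-tuple 'I_n.+1 :=
  [tuple of sort (vehicle_le E) (ord_tuple n.+1)].

Lemma vehicle_order_inj (E : 'I_n.+1 -> R) : injective (tnth (vehicle_order E)).
Proof.
by apply/tuple_uniqP; rewrite /= sort_uniq enum_uniq.
Qed.

(* The permutation [perm (vehicle_order_inj E)] sends a position h to the h-th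
   vehicle in the order; its inverse sends a vehicle to its position. *)
Definition assigned_position (E : 'I_n.+1 -> R) : 'S_n.+1 :=
  ((perm (@vehicle_order_inj E))^-1)%g.

(* [heu1_energy s h j] is E_{jh}: it is meaningful for h <= m.+1, the h-th step
   of the recursion (from 0) treating the segment renumbered h. *)
Fixpoint heu1_energy (s : 'S_m.+1) (h : nat) : 'I_n.+1 -> R :=
  if h is k.+1 then
    let E := heu1_energy s k in
    fun j => E j + seg_len I (s (inord k)) * rate I j
                   * (1 - reduction I (assigned_position E j))
  else fun=> 0.

(* The segment with original index i is treated when exactly [s^-1 i] segments
   precede it, so this is the solution in the original segment order. *)
Definition heu1 (s : 'S_m.+1) : solution n m :=
  [ffun i => assigned_position (heu1_energy s ((s^-1)%g i))].

End Platooning.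

(* Main.v *)
Require Import Defs.
From mathcomp Require Import all_boot all_order all_algebra all_fingroup.
From mathcomp Require Import lra.
Import Order.TTheory GRing.Theory Num.Theory.
Local Open Scope ring_scope.

Set Implicit Arguments.
Unset Strict Implicit.
Unset Printing Implicit Defensive.

(* Write D for the greatest segment length.  Each step of HEU1 gives the larger
   increment to the vehicle that is behind, so any two energies never differ by
   more than delta D (eta_n - eta_1).  The total energy over all vehicles is the
   same for every solution, hence some vehicle uses in the HEU1 solution at most
   what it uses in the optimal one, and Z^H <= Z^* + delta D (eta_n - eta_1).
   Finally Z^* >= delta D (1 - eta_1), because some vehicle leads the longest
   segment. *)

Section VehicleOrder.
Variables (R : realFieldType) (n : nat) (E : 'I_n.+1 -> R).

Lemma vehicle_le_trans : transitive (vehicle_le E).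
Proof.
move=> b a c /orP[ab|/andP[/eqP ab ab']] /orP[bc|/andP[/eqP bc bc']];
  rewrite /vehicle_le.
- by rewrite (lt_trans ab bc).
- by rewrite -bc ab.
- by rewrite ab bc.
- by rewrite ab bc eqxx (leq_trans ab' bc') orbT.
Qed.

Lemma vehicle_le_total : total (vehicle_le E).
Proof.
by move=> a b; rewrite /vehicle_le; case: ltgtP => //= _; exact: leq_total.
Qed.

Lemma assigned_position_le (a b : 'I_n.+1) :
  (assigned_position E a <= assigned_position E b)%N -> E a <= E b.
Proof.
(* Positions invert the sorted tuple, so comparing two positions amounts to comparing two entries of
   a sorted sequence. *)
have tnthE (c : 'I_n.+1) : c = tnth (vehicle_order E) (assigned_position E c).
  by rewrite -(permE (@vehicle_order_inj _ _ E)) /assigned_position permKV.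
rewrite {2}(tnthE a) {2}(tnthE b).
move: (assigned_position E a) (assigned_position E b) => p q pq.
have vle_refl : reflexive (vehicle_le E).
  by move=> c; rewrite /vehicle_le eqxx leqnn orbT.
have := sorted_leq_nth vehicle_le_trans vle_refl ord0
          (sort_sorted vehicle_le_total (ord_tuple n.+1)).
move=> /(_ p q); rewrite !inE size_tuple !ltn_ord => /(_ isT isT pq).
rewrite !(tnth_nth ord0) /vehicle_le.
by move=> /orP[/ltW//|/andP[/eqP -> _]].
Qed.

End VehicleOrder.

Section EqualRates.
Variables (R : realFieldType) (n m : nat) (I : instance R n m) (delta : R).
Hypothesis rateE : forall j, rate I j = delta.

Lemma delta_ge0 : 0 <= delta.
Proof. by rewrite -(rateE ord0) ltW// rate_gt0. Qed.

Lemma heu1_energy_gap (s : 'S_m.+1) (D : R) (h : nat) (a b : 'I_n.+1) :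
    (forall i, seg_len I i <= D) ->
  heu1_energy I s h a - heu1_energy I s h b
    <= delta * D * (reduction I ord_max - reduction I ord0).
Proof.
move=> leD.
have d0 := delta_ge0.
have D0 : 0 <= D by rewrite (le_trans _ (leD ord0))// ltW// seg_len_gt0.
have r0 p : reduction I ord0 <= reduction I p by exact: reduction_mono.
have r1 p : reduction I p <= reduction I ord_max.
  by apply: reduction_mono; rewrite -ltnS ltn_ord.
elim: h a b => [|h IH] a b /=.
  by rewrite subrr !mulr_ge0// subr_ge0.
rewrite !rateE; set E := heu1_energy I s h; set d := seg_len I _.
have dd0 : 0 <= d * delta by rewrite mulr_ge0// ltW// seg_len_gt0.
set p := assigned_position E a; set q := assigned_position E b.
have [pq|/ltnW qp] := leqP p q.
(* Here [a] is placed no later than [b], so the old difference is nonpositive and the new one is at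
   most the difference of the two increments. *)
- have Eab : E a <= E b by exact: assigned_position_le.
  have gap : d * delta * (reduction I q - reduction I p)
             <= delta * D * (reduction I ord_max - reduction I ord0).
    apply: ler_pM => //.
    + by rewrite subr_ge0 reduction_mono.
    + by rewrite mulrC ler_wpM2l// leD.
    + exact: lerB.
  by nra.
(* Here [a] gets at least the reduction of [b], so the difference does not grow and the induction
   hypothesis carries over. *)
- have rqp := reduction_mono I qp.
  have := IH a b; rewrite -/E.
  have : 0 <= d * delta * (reduction I p - reduction I q).
    by rewrite mulr_ge0// subr_ge0.
  by nra.
Qed.

(** In each segment every position is taken exactly once; with equal rates, reindexing by the
    permutation [x i] removes the dependence on [x]. *)
Lemma sum_energy (x : solution n m) :
  \sum_j energy I x j
    = delta * \sum_i seg_len I i * \sum_p (1 - reduction I p).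
Proof.
under eq_bigr do rewrite /energy rateE.
rewrite -mulr_sumr exchange_big /=; congr (_ * _); apply: eq_bigr => i _.
by rewrite -mulr_sumr [in RHS](reindex_inj (@perm_inj _ (x i))).
Qed.

Lemma energy_le_somewhere (x y : solution n m) :
  exists k, energy I x k <= energy I y k.
Proof.
apply/existsP; apply: contraT; rewrite negb_exists => /forallP lt_yx.
have : \sum_j energy I y j < \sum_j energy I x j.
  apply: ltr_sum => [|j _]; first by apply/hasP; exists ord0; rewrite ?mem_index_enum.
  by rewrite ltNge.
by rewrite !sum_energy ltxx.
Qed.

End EqualRates.

Section MaxEnergy.
Variables (R : realFieldType) (n m : nat) (I : instance R n m).

Lemma energy_le_max (x : solution n m) j : energy I x j <= max_energy I x.
Proof. exact: le_bigmax. Qed.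

Lemma max_energy_le (x : solution n m) (c : R) :
  (forall j, energy I x j <= c) -> max_energy I x <= c.
Proof. by move=> xc; apply: bigmax_le. Qed.

Lemma max_energy_ge_leader (x : solution n m) (delta : R) (i : 'I_m.+1) :
    (forall j, rate I j = delta) ->
  delta * seg_len I i * (1 - reduction I ord0) <= max_energy I x.
Proof.
(* The witness is the vehicle that takes the first position in segment [i]; its energy on the other
   segments is nonnegative. *)
move=> rateE; apply: le_trans (energy_le_max x ((x i)^-1 ord0)%g).
rewrite /energy rateE -mulrA; apply: ler_wpM2l; first exact: (delta_ge0 rateE).
rewrite (bigD1 i)//= permKV lerDl sumr_ge0// => k _.
by rewrite mulr_ge0// ?subr_ge0 ltW// ?seg_len_gt0 ?reduction_lt1.
Qed.

(** Unrolling the recursion gives a sum over the renumbered segments, which [s] carries back to the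
    original order. *)
Lemma energy_heu1 (s : 'S_m.+1) j :
  energy I (heu1 I s) j = heu1_energy I s m.+1 j.
Proof.
have heu1_energyE h : heu1_energy I s h j = \sum_(k < h)
    seg_len I (s (inord k)) * rate I j
    * (1 - reduction I (assigned_position (heu1_energy I s k) j)).
  by elim: h => [|h IH]; rewrite ?big_ord0// big_ord_recr /= -IH.
rewrite heu1_energyE /energy mulr_sumr (reindex_inj (@perm_inj _ s)).
by apply: eq_bigr => k _; rewrite ffunE permK inord_val mulrCA mulrA.
Qed.

End MaxEnergy.

Theorem proposition19 (R : realFieldType) (n m : nat) (I : instance R n m)
  (delta : R) (hdelta : forall j : 'I_n.+1, rate I j = delta)
  (L : R) (hL : sufficiently_large I L) (hS : energy_level_at_least I L)
  (s : 'S_m.+1) (hs : nonincreasing_reindexing I s)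
  (xopt : solution n m) (hopt : optimal I xopt) :
  max_energy I (heu1 I s) / max_energy I xopt
    <= 1 + (reduction I ord_max - reduction I ord0) / (1 - reduction I ord0).
Proof.
set D := seg_len I (s ord0); set r := _ - _; set a := 1 - _.
have leD i : seg_len I i <= D by rewrite -(permKV s i) hs.
have a0 : 0 < a by rewrite subr_gt0 reduction_lt1.
have r0 : 0 <= r by rewrite subr_ge0 reduction_mono.
have leader : delta * D * a <= max_energy I xopt by exact: max_energy_ge_leader.
have Z0 : 0 < max_energy I xopt.
  apply: lt_le_trans leader.
  by rewrite !mulr_gt0// -?(hdelta ord0) ?rate_gt0 ?seg_len_gt0.
have heu_le : max_energy I (heu1 I s) <= max_energy I xopt + delta * D * r.
  apply: max_energy_le => j.
  (* Vehicle [k] links the two solutions: [j] exceeds it by at most the gap under HEU1, and its own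
     energy is at most the optimal maximum. *)
  have [k hk] := energy_le_somewhere hdelta (heu1 I s) xopt.
  have := heu1_energy_gap hdelta s m.+1 j k leD.
  rewrite -!energy_heu1 lerBlDl => /le_trans; apply; apply: lerD => //.
  exact: le_trans hk (energy_le_max _ _ _).
(* After clearing the denominator, what remains is [leader] multiplied by [r / a]. *)
rewrite ler_pdivrMr// mulrDl mul1r (le_trans heu_le)// lerD2l.
by rewrite [leRHS]mulrAC ler_pdivlMr// mulrAC mulrC ler_wpM2l.
Qed.
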